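(* Let $D>1$ be a square-free integer and let $\eta$ be a unit of norm $-1$ in $\mathbb Q(\sqrt D)$, with conjugate $\bar\eta$. Put $\alpha=\eta^2$. Suppose that two sequences $r_n,s_n$ are rational linear combinations of $\eta^n$ and $\bar\eta^n$. Then, for every homogeneous quadratic form $Q(r,s)$ with rational coefficients, the sequence $u_n=Q(r_n,s_n)$ is a rational linear combination of $$\alpha^n,\qquad \alpha^{-n},\qquad (-1)^n .$$ Consequently $u_n$ satisfies a linear recurrence (of order at most three) whose characteristic polynomial divides $$(X-\alpha)(X-\alpha^{-1})(X+1),$$ and its ordinary generating function $\sum_{n\ge0}u_nq^n$ has denominator dividing $$(1+q)(1-\alpha q)(1-\alpha^{-1}q)=1-(\alpha+\alpha^{-1}-1)q-(\alpha+\alpha^{-1}-1)q^2+q^3 .$$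
   Context: A unit of $\mathbb Q(\sqrt D)$ means a unit of its ring of integers. ''Rational linear combination'' of sequences means a linear combination with constant coefficients (independent of $n$) in $\mathbb Q$. *)

(* Defs.v *)
From HB Require Import structures.
From mathcomp Require Import all_boot all_order all_algebra.
From mathcomp Require Import all_fingroup all_solvable all_field.

Set Implicit Arguments.
Unset Strict Implicit.
Unset Printing Implicit Defensive.

Import GRing.Theory.
Local Open Scope ring_scope.

Definition square_free (D : nat) : Prop :=
  forall m : nat, (m ^ 2 %| D)%N -> m = 1%N.

(* K is the quadratic field Q(sqrt D), with delta in the role of sqrt D.
   Requiring K to be a splittingFieldType is no restriction, since quadratic
   extensions of rat are normal; it makes the Galois norm available. *)
Definition is_Qsqrt (D : nat) (K : splittingFieldType rat) (delta : K) : Prop :=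
  delta ^+ 2 = D%:R /\ <<1; delta>>%VS = fullv.

Definition in_ring_of_integers (K : fieldExtType rat) (x : K) : Prop :=
  integralOver (intr : int -> K) x.

Definition is_integer_unit (K : fieldExtType rat) (x : K) : Prop :=
  [/\ x != 0, in_ring_of_integers x & in_ring_of_integers x^-1].

Definition quad_form (K : fieldExtType rat) (A B C : rat) (x y : K) : K :=
  A *: x ^+ 2 + B *: (x * y) + C *: y ^+ 2.

(* With p = X^d + c_(d-1) X^(d-1) + ... + c_0, this is the order d recurrence
   u_(n+d) + c_(d-1) u_(n+d-1) + ... + c_0 u_n = 0 for all n. *)
Definition recurrence_with_charpoly (K : fieldType) (p : {poly K})
    (u : nat -> K) : Prop :=
  p \is monic /\ forall n : nat, \sum_(i < size p) p`_i * u (n + i)%N = 0.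

(* The formal power series sum_n u_n q^n is the fraction N / d in lowest terms:
   the Cauchy product of d and the series is the polynomial N.  The condition
   on d`_0 makes d invertible as a power series. *)
Definition ogf_reduced_fraction (K : fieldType) (u : nat -> K)
    (N d : {poly K}) : Prop :=
  [/\ d`_0 != 0, coprimep N d
    & forall n : nat, \sum_(i < n.+1) d`_i * u (n - i)%N = N`_n].

(* Main.v *)
Require Import Defs.
From HB Require Import structures.
From mathcomp Require Import all_boot all_order all_algebra.
From mathcomp Require Import all_fingroup all_solvable all_field.
From mathcomp Require Import ring zify.

Set Implicit Arguments.
Unset Strict Implicit.
Unset Printing Implicit Defensive.

Import GRing.Theory.
Local Open Scope ring_scope.

(** The Galois group of Q(sqrt D) over Q is {1, conj}, so the norm of eta is
    eta * conj eta ([galNorm_quadratic]), and norm -1 says that the conjugate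
    of eta is - eta^-1.  A quadratic form evaluated on combinations of eta^n
    and (conj eta)^n is a combination of the n-th powers of the three products
    eta^2 = alpha, (conj eta)^2 = alpha^-1 and eta * conj eta = -1
    ([quad_form_powers]); this is the closed form of u.

    Each of alpha, alpha^-1 and -1 is a root of
    p = (X - alpha)(X - alpha^-1)(X + 1), and the powers of a root of p satisfy
    the recurrence with characteristic polynomial p ([recurrence_geometric]).
    By linearity u satisfies it too.

    A recurrence with characteristic polynomial p says that the product of the
    generating function with the reversed polynomial of p is a polynomial N.
    Here p is palindromic, because its roots are permuted by x |-> x^-1 and
    its constant coefficient is 1, so the reversed polynomial P is p itself,
    expanded as in the last claim.  Dividing N and P by their gcd gives the
    fraction in lowest terms ([ogf_of_recurrence]).  The gcd may be cancelled
    from an identity of power series because its constant coefficient,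
    a factor of that of P, is nonzero ([cauchy_prod_cancel]). *)

(** * Conjugation and norm in a quadratic field *)

(** An automorphism is determined by the image of delta, and this image is a
    square root of c, hence delta or - delta.  These two differ because K has
    characteristic 0 and delta is nonzero. *)
Lemma gal_quadraticE (K : splittingFieldType rat) (delta : K) (c : rat)
    (sigma : gal_of {:K}) :
    c != 0 -> delta ^+ 2 = c%:A -> <<1; delta>>%VS = fullv ->
    sigma delta = - delta ->
  'Gal({:K} / 1)%g =i [set 1%g; sigma] /\ 1%g != sigma.
Proof.
move=> c0 sqd gend sigd.
have dN : delta != - delta.
  rewrite -subr_eq0 opprK -mulr2n -scaler_nat scaler_eq0 Num.Theory.pnatr_eq0 /=.
  by rewrite -sqrf_eq0 sqd scaler_eq0 oner_eq0 orbF.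
have inG (x : gal_of {:K}) : x \in 'Gal({:K} / 1)%g.
  by rewrite gal_kHom ?sub1v // k1AHom.
have galE (x y : gal_of {:K}) : (x == y) = (x delta == y delta).
  have := inG x; have := inG y; move: x y; rewrite -gend => x y Gy Gx.
  exact: gal_adjoin_eq Gx Gy.
split=> [x|]; last by rewrite galE gal_id sigd.
rewrite inG in_set2 !galE gal_id sigd -eqf_sqr -rmorphXn /= sqd.
by rewrite rmorph_alg eqxx.
Qed.

Lemma galNorm_quadratic (K : splittingFieldType rat) (delta : K) (c : rat)
    (sigma : gal_of {:K}) (x : K) :
    c != 0 -> delta ^+ 2 = c%:A -> <<1; delta>>%VS = fullv ->
    sigma delta = - delta ->
  galNorm 1 {:K} x = x * sigma x.
Proof.
move=> c0 sqd gend sigd.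
have [galE sigN1] := gal_quadraticE c0 sqd gend sigd.
by rewrite /galNorm (eq_bigl _ _ galE) big_setU1 ?in_set1 //= big_set1 gal_id.
Qed.

(** * Quadratic forms in combinations of two geometric sequences *)

(** Every product of two of the sequences x^n and y^n is geometric, with ratio
    x^2, y^2 or x * y. *)
Lemma quad_form_powers (K : fieldExtType rat) (x y : K) (r s : nat -> K)
    (A B C : rat) :
    (exists a b : rat, forall n, r n = a *: x ^+ n + b *: y ^+ n) ->
    (exists a b : rat, forall n, s n = a *: x ^+ n + b *: y ^+ n) ->
  exists a b c : rat, forall n, quad_form A B C (r n) (s n) =
    a *: (x ^+ 2) ^+ n + b *: (y ^+ 2) ^+ n + c *: (x * y) ^+ n.
Proof.
move=> [a [b rE]] [c [d sE]].
exists (A * a ^+ 2 + B * (a * c) + C * c ^+ 2).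
exists (A * b ^+ 2 + B * (b * d) + C * d ^+ 2).
exists (A * (a * b) *+ 2 + B * (a * d + b * c) + C * (c * d) *+ 2) => n.
(* The morphism f makes the rational scalars ordinary ring elements, so that
   the claim becomes a polynomial identity in X = x^n and Y = y^n. *)
have [f scaleE] : exists f : {rmorphism rat -> K}, forall e z, e *: z = f e * z.
  by exists (in_alg K) => e z; rewrite /= mulr_algl.
rewrite /quad_form rE sE (exprMn n x y) -!exprM ![(2 * n)%N]mulnC !exprM.
rewrite !scaleE !(rmorphD, rmorphM, rmorphXn, rmorphMn).
by move: (x ^+ n) (y ^+ n) => X Y; ring.
Qed.

(** * Recurrences and generating functions *)

Lemma recurrence_geometric (R : comNzRingType) (p : {poly R}) (x : R) (n : nat) :
  root p x -> \sum_(i < size p) p`_i * x ^+ (n + i) = 0.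
Proof.
move=> /rootP px; transitivity (x ^+ n * p.[x]); last by rewrite px mulr0.
rewrite horner_coef mulr_sumr.
by apply: eq_bigr => i _; rewrite exprD mulrCA.
Qed.

(** Divisibility of a difference by 'X^m expresses equality of power series up
    to order m while staying inside {poly F}, where Gauss's lemma applies. *)
Lemma dvdXnP (F : fieldType) (m : nat) (p : {poly F}) :
  reflect (forall i, (i < m)%N -> p`_i = 0) ('X^m %| p).
Proof.
apply: (iffP idP) => [/dvdpP[q ->] i im | p0]; first by rewrite coefMXn im.
rewrite -(poly_take_drop m p) dvdp_addl ?dvdp_mull //.
suff -> : take_poly m p = 0 by rewrite dvdp0.
by apply/polyP=> i; rewrite coef_take_poly coef0; case: ifP => // /p0.
Qed.

(** A coefficient of a Cauchy product only sees an initial segment of the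
    series, so it can be computed with a polynomial truncation. *)
Lemma cauchy_prod_trunc (R : nzRingType) (p : {poly R}) (u : nat -> R)
    (m n : nat) : (n < m)%N ->
  \sum_(i < n.+1) p`_i * u (n - i)%N = (p * \poly_(j < m) u j)`_n.
Proof.
move=> nm; rewrite coefM; apply: eq_bigr => i _.
by rewrite coef_poly (leq_ltn_trans (leq_subr _ _) nm).
Qed.

(** With U a truncation of u, 'X^(n+1) divides g * (d * U - N); it is coprime to
    g, whose constant coefficient is nonzero, so it divides d * U - N. *)
Lemma cauchy_prod_cancel (F : fieldType) (g d N : {poly F}) (u : nat -> F) :
    g`_0 != 0 ->
    (forall n, \sum_(i < n.+1) (g * d)`_i * u (n - i)%N = (g * N)`_n) ->
  forall n, \sum_(i < n.+1) d`_i * u (n - i)%N = N`_n.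
Proof.
move=> g0 gdu n; pose U := \poly_(j < n.+1) u j.
rewrite (cauchy_prod_trunc _ _ (ltnSn n)); apply/eqP; rewrite -subr_eq0 -coefB.
suff /dvdXnP-> : 'X^(n.+1) %| d * U - N by [].
have cop : coprimep 'X^(n.+1) g.
  by rewrite coprimep_expl // coprimep_sym coprimepX /root horner_coef0.
rewrite -(Gauss_dvdpr _ cop); apply/dvdXnP=> i lin.
by rewrite mulrBr mulrA coefB -(cauchy_prod_trunc _ _ lin) gdu subrr.
Qed.

(** Both g = gcd(N, P) and P / g have a nonzero constant coefficient, since
    the product of these two coefficients is that of P. *)
Lemma ogf_reduce (F : fieldType) (P N : {poly F}) (u : nat -> F) :
    P`_0 != 0 -> (forall n, \sum_(i < n.+1) P`_i * u (n - i)%N = N`_n) ->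
  exists N' d : {poly F}, ogf_reduced_fraction u N' d /\ d %| P.
Proof.
move=> P0 PuN; pose g := gcdp N P.
have gP : g * (P %/ g) = P by rewrite mulrC divpK ?dvdp_gcdr.
have gN : g * (N %/ g) = N by rewrite mulrC divpK ?dvdp_gcdl.
have /andP[g0 d0] : (g`_0 != 0) && ((P %/ g)`_0 != 0).
  by move: P0; rewrite -{1}gP coef0M mulf_eq0 negb_or.
exists (N %/ g), (P %/ g); split; last by rewrite -{2}gP dvdp_mull.
split=> //.
  rewrite coprimep_div_gcd //; apply/orP; right.
  by apply: contraNneq P0 => ->; rewrite coef0.
by apply: (cauchy_prod_cancel g0) => n; rewrite gP gN.
Qed.

(** The numerator N collects the coefficients of degree below deg p of the
    product of the generating function with the reversed polynomial of p.  For
    n >= deg p, its coefficient of degree n is the recurrence at n - deg p,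
    summed in the opposite order. *)
Lemma ogf_of_recurrence (F : fieldType) (p : {poly F}) (u : nat -> F) :
    recurrence_with_charpoly p u ->
  exists N d : {poly F}, ogf_reduced_fraction u N d /\
    d %| \poly_(i < size p) p`_((size p).-1 - i).
Proof.
move=> [/monicP lp rec]; set P := \poly_(i < _) _.
have p_gt0 : (0 < size p)%N.
  by rewrite lt0n size_poly_eq0 -lead_coef_eq0 lp oner_eq0.
have PiE i : (i < size p)%N -> P`_i = p`_((size p).-1 - i).
  by move=> ip; rewrite coef_poly ip.
pose N := \poly_(n < (size p).-1) \sum_(i < n.+1) P`_i * u (n - i)%N.
apply: (@ogf_reduce F P N) => [|n].
  by rewrite PiE // subn0 -lead_coefE lp oner_eq0.
rewrite coef_poly; case: ltnP => // le_pn.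
have le_pn1 : (size p <= n.+1)%N by rewrite -(prednK p_gt0).
have -> : \sum_(i < n.+1) P`_i * u (n - i)%N
        = \sum_(i < size p) P`_i * u (n - i)%N.
  rewrite (big_ord_widen _ (fun i => P`_i * u (n - i)%N) le_pn1).
  rewrite [RHS]big_mkcond; apply: eq_bigr => i _.
  by case: ifP => // ip; rewrite coef_poly ip mul0r.
rewrite -[RHS](rec (n - (size p).-1)%N) (reindex_inj rev_ord_inj) /=.
have idx j m : (j < m)%N -> (m.-1 <= n)%N ->
    (m.-1 - (m - j.+1) = j)%N /\ (n - (m - j.+1) = n - m.-1 + j)%N.
  by lia.
apply: eq_bigr => i _.
rewrite PiE; last by rewrite ltn_subrL.
by have [-> ->] := idx _ _ (ltn_ord i) le_pn.
Qed.

(** * Quadratic forms in powers of a unit of norm -1 *)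

Theorem theorem3p1 (D : nat) (hD1 : (1 < D)%N) (hD : square_free D)
    (K : splittingFieldType rat) (delta : K) (hK : is_Qsqrt D delta)
    (conj : gal_of {:K}) (hconj : conj delta = - delta)
    (eta : K) (heta : is_integer_unit eta)
    (hnorm : galNorm 1 {:K} eta = -1)
    (r s : nat -> K)
    (hr : exists a b : rat,
        forall n, r n = a *: eta ^+ n + b *: (conj eta) ^+ n)
    (hs : exists a b : rat,
        forall n, s n = a *: eta ^+ n + b *: (conj eta) ^+ n)
    (A B C : rat) :
  let alpha := eta ^+ 2 in
  let u := fun n : nat => quad_form A B C (r n) (s n) in
  let t := alpha + alpha^-1 - 1 in
  let P := (1 + 'X) * (1 - alpha *: 'X) * (1 - alpha^-1 *: 'X) : {poly K} in
  [/\ exists a b c : rat, forall n,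
        u n = a *: alpha ^+ n + b *: alpha ^- n + c *: (-1) ^+ n,
      exists p : {poly K},
        [/\ recurrence_with_charpoly p u,
            ((size p).-1 <= 3)%N
          & p %| ('X - alpha%:P) * ('X - (alpha^-1)%:P) * ('X + 1)],
      exists N d : {poly K}, ogf_reduced_fraction u N d /\ d %| P
    & P = 1 - t *: 'X - t *: 'X^2 + 'X^3].
Proof.
move=> alpha u t P.
have [sqd gend] := hK; have [eta0 _ _] := heta.
have D0 : D%:R != 0 :> rat by rewrite Num.Theory.pnatr_eq0 -lt0n ltnW.
have sqd' : delta ^+ 2 = (D%:R : rat)%:A by rewrite sqd scaler_nat.
have norm_eta : eta * conj eta = -1.
  by rewrite -hnorm (galNorm_quadratic _ D0 sqd' gend hconj).
have alpha0 : alpha != 0 by rewrite expf_neq0.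
have conj_sq : conj eta ^+ 2 = alpha^-1.
  apply: (mulfI alpha0); rewrite mulfV // -exprMn norm_eta.
  by rewrite sqrrN expr1n.
have [a [b [c uE]]] : exists a b c : rat, forall n,
    u n = a *: alpha ^+ n + b *: alpha ^- n + c *: (-1) ^+ n.
  have [a [b [c uE]]] := quad_form_powers A B C hr hs.
  by exists a, b, c => n; rewrite /u uE conj_sq norm_eta exprVn.
pose p := ('X - alpha%:P) * ('X - (alpha^-1)%:P) * ('X + 1).
have alphaV : alpha%:P * alpha^-1%:P = 1 :> {poly K}.
  by rewrite -polyCM mulfV.
have PE : P = 1 - t *: 'X - t *: 'X^2 + 'X^3.
  rewrite /P /t -!mul_polyC !polyCB polyCD polyC1; ring: alphaV.
have pE : p = P by rewrite /P /p -!mul_polyC; ring: alphaV.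
have X1 : 'X + 1 = 'X - (-1)%:P :> {poly K} by rewrite polyCN opprK.
have p_monic : p \is monic.
  by rewrite /p X1 !monicMl ?monicXsubC.
have p_size : size p = 4.
  by rewrite /p X1 !size_mul ?mulf_neq0 ?polyXsubC_eq0 ?size_XsubC.
have p_rec : recurrence_with_charpoly p u.
  split=> // n.
  have p_root x : [|| x == alpha, x == alpha^-1 | x == -1] -> root p x.
    by rewrite /p !rootM !root_XsubC X1 root_XsubC -orbA.
  rewrite (eq_bigr (fun i : 'I__ => a *: (p`_i * alpha ^+ (n + i)) +
    b *: (p`_i * alpha^-1 ^+ (n + i)) + c *: (p`_i * (-1) ^+ (n + i)))).
    by rewrite !big_split -!scaler_sumr /= !recurrence_geometric ?p_root
         ?eqxx ?orbT // !scaler0 !addr0.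
  by move=> i _; rewrite uE exprVn !mulrDr !scalerAr.
have p_palindromic : \poly_(i < size p) p`_((size p).-1 - i) = P.
  apply/polyP=> i; rewrite coef_poly p_size -pE.
  case: ltnP => i4; last by rewrite nth_default ?p_size.
  rewrite pE PE !coefE.
  by move: i4; case: i => [|[|[|[|i]]]] //= _; ring.
split=> //; first by exists a, b, c.
  by exists p; rewrite p_size.
by rewrite -p_palindromic; apply: ogf_of_recurrence.
Qed.
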